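(* Let $E>0$, $f_{ex}\in L^2(\mathcal F)$ with $\|f_{ex}\|_{L^2(\mathcal F)}\le E$, $g_{ex}=H_Tf_{ex}$, and let $g\in L^2(\mathcal G)$ be a noisy measurement with $\|g-g_{ex}\|_{L^2(\mathcal G)}\le\delta$, $\delta>0$. The truncated SVD estimate $$f_{N(\delta)} = \sum_{n=-\infty}^{N(\delta)} \langle g, v_n\rangle\, \frac{1}{\sigma_n}\, u_n$$ with the cut-off index $$N(\delta) = \frac{1}{\alpha} \log \left( \frac{E A V_\mu}{\delta} \right),\qquad V_\mu = \frac{ \beta_\mu}{\alpha - \beta_\mu} \left( \frac{ 1- e^{-2 (\alpha-\beta_\mu)} }{ e^{2 \beta_\mu} -1 } \right)^{1/2},$$ guarantees regularization in the sense that $$\lim_{\delta \rightarrow 0} \| \chi_\mu (f_{N(\delta)} - f_{ex})\|_{L^2(\mathcal F)}=0.$$ Specifically, if $N(\delta) > N_\mu$, then, with $N=N(\delta)$, $$\| \chi_\mu (f_{N} - f_{ex}) \|_{L^2(\mathcal F)} \leq \frac{\delta e^{\alpha N_\mu}}{A} + E B_\mu \left( \frac{\delta}{A V_\mu E} \right)^{\beta_\mu / \alpha} \frac{\alpha}{(\alpha - \beta_\mu) \sqrt{e^{2 \beta_\mu}-1}}.$$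
   Context: Let $a_1<a_2<a_3<a_4$ be real numbers, $\mathcal F=(a_2,a_4)$, $\mathcal G=(a_1,a_3)$. The truncated Hilbert transform $H_T:L^2(\mathcal F)\to L^2(\mathcal G)$ is $$(H_Tf)(x)=\frac1\pi\,\mathrm{p.v.}\!\int_{a_2}^{a_4}\frac{f(y)}{y-x}\,dy,\qquad x\in(a_1,a_3).$$ Its singular system is $(u_n,v_n,\sigma_n)_{n\in\mathbb Z}$: $u_n\in L^2(\mathcal F)$ and $v_n\in L^2(\mathcal G)$ are normalized singular functions forming orthonormal bases of the two spaces, $H_Tu_n=\sigma_nv_n$, and $\sigma_n$ is ordered decreasingly in $n\in\mathbb Z$, with $\sigma_n\to1$ as $n\to-\infty$ and $\sigma_n\to0$ as $n\to\infty$. Put $P(x)=(x-a_1)(x-a_2)(x-a_3)(x-a_4)$, $K_-=\int_{a_1}^{a_2}\frac{dx}{\sqrt{-P(x)}}$, $K_+=\int_{a_2}^{a_3}\frac{dx}{\sqrt{P(x)}}$. The indexing of the singular system is such that, for some small $\zeta>0$, $\sigma_n=2e^{-n\pi K_+/K_-}(1+O(n^{-1/2+\zeta}))$ as $n\to\infty$. A small $\mu>0$ is fixed, and $\chi_\mu$ denotes (multiplication by) the characteristic function of $(a_2,a_3-\mu)$. Set $\alpha=\pi K_+/K_-$ and $\beta_\mu=\frac{\pi}{K_-}\int_{a_3-\mu}^{a_3}\frac{dt}{\sqrt{P(t)}}$ (so $\alpha>\beta_\mu>0$). The following properties are standing assumptions: (P1) $0<\sigma_n<1$; (P2) there are $N_0\in\mathbb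 N$ and a positive real $A$ $(A<2)$ such that $\sigma_n\ge Ae^{-\alpha n}$ for $n>N_0$; (P3) there are $N_\mu\in\mathbb N$ and a positive real $B_\mu$ such that $\|\chi_\mu u_n\|_{L^2(\mathcal F)}\le B_\mu e^{-\beta_\mu n}$ for $n>N_\mu$. $N_\mu$ is selected with $N_\mu>N_0$. Convention: the cut-off $N(\delta)$ is given by the real-valued formula in the claim; $N$ is treated as a real variable, and the fact that the index takes only integer values is neglected. In the limit $\delta\to0$, $f_{ex}$ and $E$ are fixed and $g$ may vary with $\delta$ subject to $\|g-g_{ex}\|_{L^2(\mathcal G)}\le\delta$.
   Formalization: The sum up to a non-integer N(δ) is read as the sum over n ≤ ⌊N(δ)⌋; the explicit bound is stated as written when N(δ) is an integer, and otherwise with its second term multiplied by an explicit rounding factor depending on N(δ) − ⌊N(δ)⌋. The limit is stated for all δ → 0. *)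

(* Defs.v *)
From HB Require Import structures.
From mathcomp Require Import all_boot all_order all_algebra.
From mathcomp Require Import all_classical all_reals all_analysis.

Set Implicit Arguments.
Unset Strict Implicit.
Unset Printing Implicit Defensive.
Import Order.TTheory GRing.Theory Num.Theory.
Import numFieldNormedType.Exports.
Local Open Scope classical_set_scope.
Local Open Scope ring_scope.

(* L^2(a, b) is [Lfun (leb_itv a b) 2%:E]; its elements are real-valued
   representatives, defined on all of R, whose values outside ]a, b[ are
   irrelevant for the measure [leb_itv a b]. *)
Definition leb_itv {R : realType} (a b : R) : {measure set _ -> \bar R} :=
  mrestr (@lebesgue_measure R) (measurable_itv `]a, b[).

Section L2.
Context {R : realType} (nu : {measure set (measurableTypeR R) -> \bar R}).
Implicit Types (f g : R -> R) (c : int -> R) (e : int -> R -> R).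

Definition L2 f : Prop := f \in Lfun nu 2%:E.

Definition L2norm f : R := fine ('N[nu]_2%:E [EFin \o f])%E.

Definition L2inner f g : R := \int[nu]_x (f x * g x).

Definition L2cvg (s : nat -> R -> R) f : Prop :=
  L2norm (fun x => s k x - f x) @[k --> \oo] --> (0 : R).

(* The sum of c_n e_n over the k consecutive indices m - k < n <= m. *)
Definition window_sum c e (m : int) (k : nat) : R -> R :=
  fun x => \sum_(j < k) c (m - j%:Z) * e (m - j%:Z) x.

(* Orthonormality, and f is the L^2-limit of the sums of <f, e_n> e_n over
   -k <= n <= k. *)
Definition orthonormal_basis e : Prop :=
  [/\ forall n, L2 (e n),
      forall m n, L2inner (e m) (e n) = (m == n)%:R &
      forall f, L2 f ->
        L2cvg (fun k => window_sum (fun n => L2inner f (e n)) e k%:Z k.*2.+1) f].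

End L2.

Section TruncatedHilbert.
Context {R : realType} (a1 a2 a3 a4 : R).

Local Notation leb := (@lebesgue_measure R).
Local Notation muF := (leb_itv a2 a4).
Local Notation muG := (leb_itv a1 a3).

Definition HT_eps (f : R -> R) (eps x : R) : R :=
  pi^-1 * \int[leb]_(y in `]a2, a4[ `&` [set y | eps < `|y - x| ])
            (f y / (y - x)).

(* H_T f = h, as a relation between elements of L^2(a2, a4) and L^2(a1, a3):
   the principal value exists and equals h almost everywhere on ]a1, a3[. *)
Definition HT_eq (f h : R -> R) : Prop :=
  [/\ L2 muF f, L2 muG h &
      {ae muG, forall x, HT_eps f eps x @[eps --> 0^'+] --> h x}].

(* [ss_adj] spells out H_T^* v_n = sigma_n u_n through the defining relation
   <H_T f, v_n> = <f, sigma_n u_n> of the adjoint. *)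
Record singular_system (u v : int -> R -> R) (s : int -> R) : Prop := {
  ss_u : orthonormal_basis muF u;
  ss_v : orthonormal_basis muG v;
  ss_HT : forall n, HT_eq (u n) (fun x => s n * v n x);
  ss_adj : forall n f h, HT_eq f h ->
    L2inner muG h (v n) = L2inner muF f (fun x => s n * u n x);
  ss_decr : forall m n, (m <= n)%R -> s n <= s m;
  ss_ninfty : s (- k%:Z) @[k --> \oo] --> (1 : R);
  ss_pinfty : s k%:Z @[k --> \oo] --> (0 : R)
}.

Definition quartic (x : R) : R := (x - a1) * (x - a2) * (x - a3) * (x - a4).

Definition Kminus : R :=
  \int[leb]_(x in `]a1, a2[) (Num.sqrt (- quartic x))^-1.

Definition Kplus : R :=
  \int[leb]_(x in `]a2, a3[) (Num.sqrt (quartic x))^-1.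

Definition alpha : R := pi * Kplus / Kminus.

Definition beta (mu : R) : R :=
  pi / Kminus * \int[leb]_(t in `]a3 - mu, a3[) (Num.sqrt (quartic t))^-1.

(* sigma_n = 2 e^{- n alpha} (1 + O(n^{-1/2 + zeta})), n -> +oo; this fixes the
   shift in the indexing of the singular system by the integers. *)
Definition singular_values_asymptotics (s : int -> R) : Prop :=
  exists zeta : R, 0 < zeta < 2^-1 /\
    (fun n : nat => s n%:Z / (2 * expR (- (alpha * n%:R))) - 1 : R^o)
      =O_\oo (fun n : nat => n%:R `^ (- 2^-1 + zeta) : R^o).

Definition chi (mu : R) (f : R -> R) : R -> R :=
  fun x => \1_(`]a2, a3 - mu[%classic) x * f x.

(* f is the sum over the integers n <= N of <g, v_n> sigma_n^{-1} u_n,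
   convergent in L^2(a2, a4), for a real cut-off N. *)
Definition tsvd (u v : int -> R -> R) (s : int -> R) (N : R) (g f : R -> R)
    : Prop :=
  L2 muF f /\
  L2cvg muF
    (window_sum (fun n => L2inner muG g (v n) / s n) u (Num.floor N)) f.

Definition Vmu (mu : R) : R :=
  beta mu / (alpha - beta mu) *
  Num.sqrt ((1 - expR (- 2 * (alpha - beta mu))) / (expR (2 * beta mu) - 1)).

Definition cutoff (E A mu delta : R) : R :=
  alpha^-1 * ln (E * A * Vmu mu / delta).

(* Equal to 1 at theta = 0. With theta = N - floor N, it is the correction to
   the second term of the error bound when the real cut-off N is rounded down:
   it comes from summing the two geometric series up to, resp. from beyond, the
   integer N - theta instead of N. *)
Definition rounding (mu theta : R) : R :=
  (beta mu * expR (- ((alpha - beta mu) * theta)) +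
   (alpha - beta mu) * expR (beta mu * theta)) / alpha.

End TruncatedHilbert.

(* Main.v *)
Require Import Defs.
From HB Require Import structures.
From mathcomp Require Import all_boot all_order all_algebra.
From mathcomp Require Import all_classical all_reals all_analysis measurable_realfun.
From mathcomp Require Import ring lra zify.
Set Implicit Arguments.
Unset Strict Implicit.
Unset Printing Implicit Defensive.
Import Order.TTheory GRing.Theory Num.Theory.
Import numFieldNormedType.Exports.
Local Open Scope classical_set_scope.
Local Open Scope ring_scope.

(* With d_n = <g - gex, v_n> and c_n = <fex, u_n>, the error f_N - fex is
   sum_(n <= N) (d_n / s_n) u_n - sum_(n > N) c_n u_n.  The terms n <= Nmu are
   controlled in norm by orthonormality, since s_n >= s_Nmu there.  For n > Nmu
   one uses the triangle inequality after multiplication by chi_mu, the bounds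
   1 / s_n <= e^(al n) / A and ||chi_mu u_n|| <= B e^(- be n), the
   Cauchy-Schwarz and Bessel inequalities, and two geometric series.  The
   cut-off balances the two resulting terms.  That al > 0 follows from
   s_n >= A e^(- al n) and s_n -> 0; then be is a positive part of al. *)

(** * Real-valued L^2 functions *)

Section L2Theory.
Context {R : realType} (nu : {measure set (measurableTypeR R) -> \bar R}).
Implicit Types f g h : R -> R.

Lemma L2_measurable f : L2 nu f -> measurable_fun [set: measurableTypeR R] f.
Proof. by rewrite /L2 inE => /andP[+ _]; rewrite inE. Qed.

Lemma L2D f g : L2 nu f -> L2 nu g -> L2 nu (fun x => f x + g x).
Proof.
move=> Lf Lg.
by have := @Lfun_addr_closed _ _ _ nu _ (lee1n 2); case=> _; apply.
Qed.

Lemma L2Z a f : L2 nu f -> L2 nu (fun x => a * f x).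
Proof.
move=> Lf.
have := @Lfun_submod_closed _ _ _ nu _ (lee1n 2).
case=> L0 /(_ a f (cst 0) Lf L0).
rewrite /L2; have -> // : a *: f + cst 0 = (fun x => a * f x).
by apply/funext => x; exact: addr0.
Qed.

Lemma L2B f g : L2 nu f -> L2 nu g -> L2 nu (fun x => f x - g x).
Proof.
move=> Lf /(L2Z (-1)) /(L2D Lf).
by have -> : (fun x => f x + -1 * g x) = (fun x => f x - g x)
  by apply/funext => x; rewrite mulN1r.
Qed.

Lemma L2_sum (I : Type) (r : seq I) (F : I -> R -> R) :
  (forall i, L2 nu (F i)) -> L2 nu (fun x => \sum_(i <- r) F i x).
Proof.
move=> LF; elim: r => [|i r IH].
  have [L0 _] := @Lfun_addr_closed _ _ _ nu _ (lee1n 2).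
  by have -> : (fun x : R => \sum_(i <- [::]) F i x) = 0
    by apply/funext => x; rewrite big_nil.
have -> : (fun x : R => \sum_(j <- i :: r) F j x) =
    (fun x => F i x + \sum_(j <- r) F j x).
  by apply/funext => x; rewrite big_cons.
exact: L2D.
Qed.

Lemma L2norm_fin f : L2 nu f -> ('N[nu]_2%:E [EFin \o f] < +oo)%E.
Proof. by rewrite /L2 inE => /andP[_]; rewrite inE. Qed.

Lemma EFin_L2norm f : L2 nu f -> (L2norm nu f)%:E = ('N[nu]_2%:E [EFin \o f])%E.
Proof. by move=> /L2norm_fin Lf; rewrite fineK// ge0_fin_numE// Lnorm_ge0. Qed.

Lemma L2norm_ge0 f : 0 <= L2norm nu f.
Proof. by rewrite fine_ge0// Lnorm_ge0. Qed.

Lemma L2_integrable_mul f g : L2 nu f -> L2 nu g ->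
  nu.-integrable setT (EFin \o (fun x => f x * g x)).
Proof. by move=> Lf Lg; apply/Lfun1_integrable; exact: Lfun2_mul_Lfun1. Qed.

Lemma L2norm_sqr f : L2 nu f -> L2norm nu f ^+ 2 = L2inner nu f f.
Proof.
move=> Lf; apply: EFin_inj.
rewrite -powR_mulrn ?L2norm_ge0// -poweR_EFin EFin_L2norm// poweR_Lnorm//.
(* The real integral is [fine] of the extended one, so integrability of [f * f] is what keeps a
   value from collapsing to 0. *)
rewrite /L2inner /Rintegral fineK; last exact/integrable_fin_num/L2_integrable_mul.
by apply: eq_integral => x _ /=; rewrite powR_mulrn// real_normK ?num_real// expr2.
Qed.

Lemma ler_L2normD f g : L2 nu f -> L2 nu g ->
  L2norm nu (fun x => f x + g x) <= L2norm nu f + L2norm nu g.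
Proof.
move=> Lf Lg; rewrite -lee_fin EFinD !EFin_L2norm//; last exact: L2D.
by apply: eminkowski; [exact: L2_measurable..|exact: lee1n].
Qed.

(** Monotonicity of the integral of the squares, then of the square root. Membership comes with the
    bound because finiteness of the norm of [f] is read off from that of [g]. *)
Lemma ler_L2norm f g : L2 nu g -> measurable_fun [set: measurableTypeR R] f ->
  (forall x, `|f x| <= `|g x|) -> L2 nu f /\ L2norm nu f <= L2norm nu g.
Proof.
move=> Lg mf fg.
have le : ('N[nu]_2%:E [EFin \o f] <= 'N[nu]_2%:E [EFin \o g])%E.
  rewrite unlock; apply: gt0_ler_poweR => //.
  - by rewrite in_itv/= leey integral_ge0.
  - by rewrite in_itv/= leey integral_ge0.
  apply: ge0_le_integral => //=.
  - apply/measurable_EFinP.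
    apply/(@measurableT_comp _ _ _ _ _ _ (fun x : R => x `^ 2)%R) => //.
    exact/measurableT_comp.
  - apply/measurable_EFinP.
    apply/(@measurableT_comp _ _ _ _ _ _ (fun x : R => x `^ 2)%R) => //.
    by apply/measurableT_comp => //; exact: L2_measurable.
  - by move=> x _; rewrite lee_fin ge0_ler_powR// ?nnegrE.
have Lf : L2 nu f.
  rewrite /L2 inE; apply/andP; split; rewrite inE//=.
  by apply: (le_lt_trans le); exact: L2norm_fin.
by split=> //; rewrite -lee_fin !EFin_L2norm.
Qed.

Lemma L2innerC f g : L2inner nu f g = L2inner nu g f.
Proof. by apply: eq_Rintegral => x _; rewrite mulrC. Qed.

Lemma L2innerDl f g h : L2 nu f -> L2 nu g -> L2 nu h ->
  L2inner nu (fun x => f x + g x) h = L2inner nu f h + L2inner nu g h.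
Proof.
move=> Lf Lg Lh; rewrite /L2inner -RintegralD//; [|exact: L2_integrable_mul..].
by apply: eq_Rintegral => x _; rewrite mulrDl.
Qed.

Lemma L2innerZl a f h : L2 nu f -> L2 nu h ->
  L2inner nu (fun x => a * f x) h = a * L2inner nu f h.
Proof.
move=> Lf Lh; rewrite /L2inner -RintegralZl//; last exact: L2_integrable_mul.
by apply: eq_Rintegral => x _; rewrite mulrA.
Qed.

Lemma L2innerBl f g h : L2 nu f -> L2 nu g -> L2 nu h ->
  L2inner nu (fun x => f x - g x) h = L2inner nu f h - L2inner nu g h.
Proof.
move=> Lf Lg Lh; rewrite -mulN1r -L2innerZl// -L2innerDl//; last exact: L2Z.
by congr L2inner; apply/funext => x; rewrite mulN1r.
Qed.

Lemma L2inner_suml (I : Type) (r : seq I) (F : I -> R -> R) h :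
  (forall i, L2 nu (F i)) -> L2 nu h ->
  L2inner nu (fun x => \sum_(i <- r) F i x) h = \sum_(i <- r) L2inner nu (F i) h.
Proof.
move=> LF Lh; elim: r => [|i r IH].
  rewrite big_nil /L2inner; under eq_Rintegral do rewrite big_nil mul0r.
  by rewrite Rintegral_cst// mul0r.
rewrite big_cons -IH -L2innerDl//; last exact: L2_sum.
by congr L2inner; apply/funext => x; rewrite big_cons.
Qed.

Lemma L2normZ a f : L2 nu f -> L2norm nu (fun x => a * f x) = `|a| * L2norm nu f.
Proof.
move=> Lf; apply/eqP; rewrite -(@eqrXn2 _ 2)// ?mulr_ge0 ?L2norm_ge0//.
rewrite exprMn !L2norm_sqr//; last exact: L2Z.
rewrite L2innerZl//; last exact: L2Z.
by rewrite L2innerC L2innerZl// mulrA real_normK ?num_real// expr2.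
Qed.

Lemma L2normB f g : L2 nu f -> L2 nu g ->
  L2norm nu (fun x => f x - g x) = L2norm nu (fun x => g x - f x).
Proof.
move=> Lf Lg; rewrite -[RHS]mul1r -(normr1 R) -normrN -L2normZ; last exact: L2B.
by congr L2norm; apply/funext => x; rewrite mulN1r opprB.
Qed.

Lemma ler_L2norm_sum (I : Type) (r : seq I) (F : I -> R -> R) :
  (forall i, L2 nu (F i)) ->
  L2norm nu (fun x => \sum_(i <- r) F i x) <= \sum_(i <- r) L2norm nu (F i).
Proof.
move=> LF; elim: r => [|i r IH].
  have -> : (fun x : R => \sum_(i <- [::]) F i x) = (fun _ => 0).
    by apply/funext => x; rewrite big_nil.
  by rewrite big_nil /L2norm (_ : EFin \o _ = cst 0%E)// Lnorm0.
have -> : (fun x : R => \sum_(j <- i :: r) F j x) =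
    (fun x => F i x + \sum_(j <- r) F j x).
  by apply/funext => x; rewrite big_cons.
rewrite big_cons (le_trans (ler_L2normD _ _))// ?lerD2l//; exact: L2_sum.
Qed.

(** * Finite orthonormal families: Pythagoras and Bessel *)

Section Orthonormal.
Context (I : finType) (e : I -> R -> R).
Hypothesis Le : forall i, L2 nu (e i).
Hypothesis oe : forall i j, L2inner nu (e i) (e j) = (i == j)%:R.

Lemma L2inner_orthonormal_sum (c : I -> R) j :
  L2inner nu (fun x => \sum_i c i * e i x) (e j) = c j.
Proof.
rewrite L2inner_suml//; last by move=> i; exact: L2Z.
rewrite (bigD1 j)//= big1 ?addr0 => [|i ij]; rewrite L2innerZl// oe.
  by rewrite eqxx mulr1.
by rewrite (negbTE ij) mulr0.
Qed.

Lemma L2norm_orthonormal_sum (c : I -> R) :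
  L2norm nu (fun x => \sum_i c i * e i x) ^+ 2 = \sum_i c i ^+ 2.
Proof.
have Ls : L2 nu (fun x => \sum_i c i * e i x) by apply: L2_sum => i; exact: L2Z.
rewrite L2norm_sqr// L2inner_suml//; last by move=> i; exact: L2Z.
apply: eq_bigr => i _.
by rewrite L2innerZl// L2innerC L2inner_orthonormal_sum expr2.
Qed.

(** With [S] the orthogonal projection of [f] on the span of the family, [f - S] is orthogonal to
    [S], so the square of its norm is [L2norm f ^+ 2 - L2norm S ^+ 2], which is nonnegative. *)
Lemma bessel_inequality f : L2 nu f ->
  \sum_i L2inner nu f (e i) ^+ 2 <= L2norm nu f ^+ 2.
Proof.
move=> Lf; pose S x := \sum_i L2inner nu f (e i) * e i x.
have LS : L2 nu S by apply: L2_sum => i; exact: L2Z.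
have fS : L2inner nu f S = L2inner nu S S.
  rewrite L2innerC !L2inner_suml//; [|by move=> i; exact: L2Z..].
  apply: eq_bigr => i _; rewrite !L2innerZl//.
  by congr (_ * _); rewrite [RHS]L2innerC L2inner_orthonormal_sum L2innerC.
rewrite -L2norm_orthonormal_sum -/S !L2norm_sqr//.
have := sqr_ge0 (L2norm nu (fun x => f x - S x)).
have LfS := L2B Lf LS.
rewrite L2norm_sqr// L2innerBl// L2innerC (L2innerC S) !L2innerBl// fS subrr subr0.
by rewrite (L2innerC S f) fS subr_ge0.
Qed.

End Orthonormal.
End L2Theory.

(** * Windows of a two-sided orthonormal system *)

(** Lagrange's identity: twice the difference of the two sides is a double sum of squares. *)
Lemma cauchy_schwarz_sum (R : realFieldType) (I : finType) (a b : I -> R) :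
  (\sum_i a i * b i) ^+ 2 <= (\sum_i a i ^+ 2) * (\sum_i b i ^+ 2).
Proof.
have : 0 <= \sum_i \sum_j (a i * b j - a j * b i) ^+ 2.
  by apply: sumr_ge0 => i _; apply: sumr_ge0 => j _; exact: sqr_ge0.
have -> : \sum_i \sum_j (a i * b j - a j * b i) ^+ 2 =
    ((\sum_i a i ^+ 2) * (\sum_i b i ^+ 2) - (\sum_i a i * b i) ^+ 2) *+ 2.
  transitivity (\sum_i \sum_j (a i ^+ 2 * b j ^+ 2 + b i ^+ 2 * a j ^+ 2
      - (a i * b i * (a j * b j)) *+ 2)).
    by apply: eq_bigr => i _; apply: eq_bigr => j _; ring.
  under eq_bigr do rewrite big_split big_split/= -!mulr_sumr sumrN sumrMnl -mulr_sumr.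
  rewrite big_split big_split/= sumrN sumrMnl -!mulr_suml.
  by ring.
by rewrite pmulrn_lge0// subr_ge0.
Qed.

Section Windows.
Context {R : realType} (nu : {measure set (measurableTypeR R) -> \bar R}).
Implicit Types (c : int -> R) (e : int -> R -> R).

(** Windows run downwards from their top index, so the second piece starts at [m - k]. This is the
    tool for cutting partial sums at [Nmu] and at the floor of [N]. *)
Lemma window_sum_cat c e m k l x :
  window_sum c e m (k + l) x =
  window_sum c e m k x + window_sum c e (m - k%:Z) l x.
Proof.
rewrite /window_sum big_split_ord/=; congr (_ + _).
by apply: eq_bigr => j _; rewrite PoszD opprD addrA.
Qed.

Lemma window_sumD c c' e m k x :
  window_sum (fun n => c n + c' n) e m k x =
  window_sum c e m k x + window_sum c' e m k x.
Proof. by rewrite -big_split; apply: eq_bigr => j _; rewrite /= mulrDl. Qed.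

Lemma L2_window_sum c e m k : (forall n, L2 nu (e n)) ->
  L2 nu (window_sum c e m k).
Proof. by move=> Le; apply: L2_sum => j; exact: L2Z. Qed.

Context (e : int -> R -> R).
Hypothesis Le : forall n, L2 nu (e n).
Hypothesis oe : forall m n, L2inner nu (e m) (e n) = (m == n)%:R.

Lemma window_orthonormal m k (i j : 'I_k) :
  L2inner nu (e (m - i%:Z)) (e (m - j%:Z)) = (i == j)%:R.
Proof. by rewrite oe (inj_eq (addrI _)) eqr_opp. Qed.

Lemma L2norm_window_sum c m k :
  L2norm nu (window_sum c e m k) ^+ 2 = \sum_(j < k) c (m - j%:Z) ^+ 2.
Proof.
exact: (L2norm_orthonormal_sum (fun j => Le _) (@window_orthonormal m k)).
Qed.

Lemma bessel_window f m k : L2 nu f ->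
  \sum_(j < k) L2inner nu f (e (m - j%:Z)) ^+ 2 <= L2norm nu f ^+ 2.
Proof.
exact: (bessel_inequality (fun j => Le _) (@window_orthonormal m k)).
Qed.

End Windows.

(** * Multiplication by the characteristic function *)

Section Chi.
Context {R : realType} (nu : {measure set (measurableTypeR R) -> \bar R}).
Context (a b mu : R).
Implicit Types (f g : R -> R).

Lemma L2_chi f : L2 nu f ->
  L2 nu (chi a b mu f) /\ L2norm nu (chi a b mu f) <= L2norm nu f.
Proof.
move=> Lf; apply: ler_L2norm => //.
  apply: measurable_funM; last exact: L2_measurable Lf.
  exact: measurable_indic.
move=> x; rewrite /chi normrM ler_piMl// indicE.
by case: (_ \in _); rewrite ?normr1 ?normr0.
Qed.

Lemma chi_window_sum c (e : int -> R -> R) m k :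
  chi a b mu (window_sum c e m k) =
  window_sum c (fun n => chi a b mu (e n)) m k.
Proof.
apply/funext => x; rewrite /chi /window_sum mulr_sumr.
by apply: eq_bigr => j _; rewrite mulrCA.
Qed.

(** The functions [chi (e n)] are no longer orthogonal, so the triangle inequality replaces
    Pythagoras. Cauchy-Schwarz then separates a square-summable factor [d], controlled by Bessel,
    from an exponential weight [w]. *)
Lemma ler_L2norm_chi_window c (e : int -> R -> R) m k (d w : 'I_k -> R) (D W : R) :
    (forall n, L2 nu (e n)) -> 0 <= D -> 0 <= W ->
    (forall j : 'I_k, `|c (m - j%:Z)| * L2norm nu (chi a b mu (e (m - j%:Z)))
       <= d j * w j) ->
    \sum_j d j ^+ 2 <= D ^+ 2 -> \sum_j w j ^+ 2 <= W ^+ 2 ->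
  L2norm nu (chi a b mu (window_sum c e m k)) <= D * W.
Proof.
move=> Le D0 W0 cdw dD wW; rewrite chi_window_sum.
have Lx n : L2 nu (chi a b mu (e n)) by have [] := L2_chi (Le n).
apply: (@le_trans _ _ (\sum_j d j * w j)).
  apply: le_trans (ler_L2norm_sum _ _) _; first by move=> j; exact: L2Z.
  by apply: ler_sum => j _; rewrite L2normZ.
apply: le_trans (ler_norm _) _.
rewrite -(ger0_norm (mulr_ge0 D0 W0)) -ler_sqr ?nnegrE//.
rewrite !real_normK ?num_real// (le_trans (cauchy_schwarz_sum _ _))// exprMn.
by apply: ler_pM => //; apply: sumr_ge0 => j _; exact: sqr_ge0.
Qed.

End Chi.

(** * Geometric sums of exponential weights, bounded uniformly in the window length *)

Section GeometricSums.
Context {R : realType}.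
Implicit Types (g : R) (m : int) (k : nat).

Lemma geometric_sum_le (q : R) k : 0 < q < 1 ->
  \sum_(j < k) q ^+ j <= (1 - q)^-1.
Proof.
move=> /andP[q0 q1]; rewrite -[leRHS]div1r.
have := @geometric_le_lim R k 1 q ler01 q0.
rewrite ger0_norm ?(ltW q0)// => /(_ q1); rewrite /series/= big_mkord.
congr (_ <= _); apply: eq_bigr => j _; exact: mul1r.
Qed.

(** Counted down from the top index, the squares are [expR (2 * g * m)] times the powers of the
    ratio [expR (- 2 * g)]. *)
Lemma expR_sum_below g m k : 0 < g ->
  \sum_(j < k) expR (g * (m - j%:Z)%:~R) ^+ 2 <=
  (expR (g * m%:~R) / Num.sqrt (1 - expR (- 2 * g))) ^+ 2.
Proof.
move=> g0; have q1 : expR (- 2 * g) < 1 by rewrite expR_lt1; lra.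
rewrite exprMn exprVn sqr_sqrtr ?subr_ge0 ?(ltW q1)//.
have q01 : 0 < expR (- 2 * g) < 1 by rewrite expR_gt0.
apply: (le_trans _ (ler_wpM2l (sqr_ge0 _) (geometric_sum_le k q01))).
rewrite mulr_sumr; apply: ler_sum => j _.
rewrite -!expRM_natl -expRD ler_expR rmorphB/= -!pmulrn; lra.
Qed.

Lemma expR_sum_above g m k : 0 < g ->
  \sum_(j < k) expR (- (g * (m + k%:Z - j%:Z)%:~R)) ^+ 2 <=
  (expR (- (g * m%:~R)) / Num.sqrt (expR (2 * g) - 1)) ^+ 2.
Proof.
move=> g0; have q1 : 1 < expR (2 * g) by rewrite expR_gt1; lra.
rewrite exprMn exprVn sqr_sqrtr ?subr_ge0 ?(ltW q1)//.
(* The lowest index of this window is [m + 1], not [m]; the extra factor [expR (- 2 * g)] turns the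
   usual geometric limit into the inverse of [expR (2 * g) - 1]. *)
have -> : (expR (2 * g) - 1)^-1 = expR (- 2 * g) * (1 - expR (- 2 * g))^-1.
  rewrite mulNr expRN; field.
  by rewrite !gt_eqF ?subr_gt0 ?expR_gt0 ?q1.
rewrite mulrA.
have q01 : 0 < expR (- 2 * g) < 1 by rewrite expR_gt0 expR_lt1/=; lra.
apply: (le_trans _ (ler_wpM2l _ (geometric_sum_le k q01))); last first.
  by rewrite mulr_ge0 ?sqr_ge0 ?expR_ge0.
(* Reversing the order lists the window upwards from [m + 1], so that the terms decrease
   geometrically. *)
rewrite (reindex_inj rev_ord_inj) mulr_sumr; apply: ler_sum => j _ /=.
have -> : (m + k%:Z - (k - j.+1)%N%:Z)%:~R = m%:~R + 1 + j%:R :> R.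
  have -> : m + k%:Z - (k - j.+1)%N%:Z = m + 1 + j%:Z by have := ltn_ord j; lia.
  by rewrite !rmorphD.
rewrite -!expRM_natl -!expRD ler_expR; lra.
Qed.

End GeometricSums.

(** * The error of the truncated expansion *)

Section ErrorBound.
Context {R : realType} (a1 a2 a3 a4 mu : R).
Context (u v : int -> R -> R) (s : int -> R).
Hypothesis hsvd : singular_system a1 a2 a3 a4 u v s.
Hypothesis s_gt0 : forall n, 0 < s n.
Local Notation muF := (leb_itv a2 a4).
Local Notation muG := (leb_itv a1 a3).
Local Notation Chi := (chi a2 a3 mu).

(** The adjoint relation makes the [n]-th coefficient of [gex] equal to [s n] times that of [fex],
    so dividing by [s n] recovers the exact coefficient and leaves only the amplified noise. *)
Lemma ss_coef n fex gex g : HT_eq a1 a2 a3 a4 fex gex -> L2 muG g ->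
  L2inner muG g (v n) / s n =
  L2inner muG (fun x => g x - gex x) (v n) / s n + L2inner muF fex (u n).
Proof.
move=> hgex Lg; have [Lfex Lgex _] := hgex.
have [Lu _ _] := ss_u hsvd; have [Lv _ _] := ss_v hsvd.
rewrite L2innerBl// (ss_adj hsvd n hgex).
rewrite L2innerC [in X in _ - X]L2innerC L2innerZl// [X in s n * X]L2innerC mulrBl.
by rewrite (mulrC (s n)) mulfK ?gt_eqF// subrK.
Qed.

Context (al be A B E : R) (N0 Nmu : nat).
Hypotheses (be_gt0 : 0 < be) (be_lt : be < al) (A_gt0 : 0 < A) (B_gt0 : 0 < B)
  (E_gt0 : 0 < E) (hN : (N0 < Nmu)%N).
Hypothesis s_ge : forall n : int, N0%:Z < n ->
  A * expR (- (al * n%:~R)) <= s n.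
Hypothesis chi_le : forall n : int, Nmu%:Z < n ->
  L2norm muF (Chi (u n)) <= B * expR (- (be * n%:~R)).

Lemma inv_s_le n : N0%:Z < n -> (s n)^-1 <= expR (al * n%:~R) / A.
Proof.
move=> /s_ge sn; rewrite -[leRHS]invrK invf_div -expRN.
by rewrite lef_pV2 ?posrE ?mulr_gt0 ?expR_gt0.
Qed.

Lemma low_window_bound (d : int -> R) (delta : R) k : 0 <= delta ->
    \sum_(j < k) d (Nmu%:Z - j%:Z) ^+ 2 <= delta ^+ 2 ->
  L2norm muF (Chi (window_sum (fun n => d n / s n) u Nmu%:Z k)) <=
    delta * expR (al * Nmu%:R) / A.
Proof.
move=> delta0 hd; have [Lu ou _] := ss_u hsvd.
have [_] := L2_chi a2 a3 mu (L2_window_sum (fun n => d n / s n) Nmu%:Z k Lu).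
move=> /le_trans; apply.
(* [hN] puts [Nmu] itself in the range of [s_ge]; by monotonicity of [s] this bounds every
   amplification factor of the window. *)
have hs : (s Nmu)^-1 <= expR (al * Nmu%:R) / A by exact: inv_s_le.
rewrite -mulrA; apply: (@le_trans _ _ (delta * (s Nmu)^-1)); last first.
  by rewrite ler_wpM2l.
rewrite -ler_sqr ?nnegrE ?L2norm_ge0 ?mulr_ge0 ?invr_ge0 ?(ltW (s_gt0 _))//.
rewrite L2norm_window_sum// exprMn (le_trans _ (ler_wpM2r _ hd)) ?sqr_ge0//.
rewrite mulr_suml; apply: ler_sum => j _; rewrite exprMn ler_wpM2l ?sqr_ge0//.
rewrite ler_sqr ?nnegrE ?invr_ge0 ?(ltW (s_gt0 _))// lef_pV2 ?posrE//.
by apply: (ss_decr hsvd); rewrite gerBl.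
Qed.

(** The amplification [expR (al * n) / A] is partly offset by the decay of [Chi (u n)]. The net
    weight grows at rate [al - be], so the top index dominates. *)
Lemma mid_window_bound (d : int -> R) (delta : R) k : 0 <= delta ->
    \sum_(j < k) d (Nmu%:Z + k%:Z - j%:Z) ^+ 2 <= delta ^+ 2 ->
  L2norm muF (Chi (window_sum (fun n => d n / s n) u (Nmu%:Z + k%:Z) k)) <=
    delta * (B / A * (expR ((al - be) * (Nmu%:Z + k%:Z)%:~R) /
             Num.sqrt (1 - expR (- 2 * (al - be))))).
Proof.
move=> delta0 hd; have [Lu ou _] := ss_u hsvd.
have BA : 0 <= B / A by rewrite divr_ge0 ?ltW.
apply: (@ler_L2norm_chi_window _ _ _ _ _ _ _ _ _ (fun j => `|d (Nmu%:Z + k%:Z - j%:Z)|)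
  (fun j => B / A * expR ((al - be) * (Nmu%:Z + k%:Z - j%:Z)%:~R))) => //.
- by rewrite !mulr_ge0 ?invr_ge0 ?sqrtr_ge0 ?expR_ge0 ?(ltW A_gt0) ?(ltW B_gt0).
- move=> j /=; set n := _ - _.
  have Nn : Nmu%:Z < n by rewrite /n; have := ltn_ord j; lia.
  rewrite normrM normfV (gtr0_norm (s_gt0 n)) -[leLHS]mulrA ler_wpM2l//.
  apply: (@le_trans _ _ (expR (al * n%:~R) / A * (B * expR (- (be * n%:~R))))).
    apply: ler_pM; rewrite ?invr_ge0 ?(ltW (s_gt0 _)) ?L2norm_ge0 ?chi_le//.
    by apply: inv_s_le; rewrite (lt_trans _ Nn)// ltz_nat.
  rewrite le_eqVlt; apply/orP; left; apply/eqP.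
  by rewrite mulrBl expRD; ring.
- by under eq_bigr do rewrite real_normK ?num_real//.
- under eq_bigr do rewrite exprMn; rewrite -mulr_sumr [leRHS]exprMn.
  by rewrite ler_wpM2l ?sqr_ge0// expR_sum_below// subr_gt0.
Qed.

(** These are the coefficients of [fex] lost by truncation: nothing is divided by [s n], and the
    decay of [Chi (u n)] alone makes the tail small. *)
Lemma high_window_bound (c : int -> R) (M : int) k : Nmu%:Z <= M ->
    \sum_(j < k) c (M + k%:Z - j%:Z) ^+ 2 <= E ^+ 2 ->
  L2norm muF (Chi (window_sum c u (M + k%:Z) k)) <=
    E * (B * (expR (- (be * M%:~R)) / Num.sqrt (expR (2 * be) - 1))).
Proof.
move=> NM hc; have [Lu ou _] := ss_u hsvd.
apply: (@ler_L2norm_chi_window _ _ _ _ _ _ _ _ _ (fun j => `|c (M + k%:Z - j%:Z)|)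
  (fun j => B * expR (- (be * (M + k%:Z - j%:Z)%:~R)))) => //.
- exact: ltW.
- by rewrite !mulr_ge0 ?invr_ge0 ?sqrtr_ge0 ?expR_ge0 ?ltW.
- move=> j /=; rewrite ler_wpM2l//; apply: chi_le.
  by have := ltn_ord j; lia.
- by under eq_bigr do rewrite real_normK ?num_real//.
- under eq_bigr do rewrite exprMn; rewrite -mulr_sumr [leRHS]exprMn.
  by rewrite ler_wpM2l ?sqr_ge0// expR_sum_above.
Qed.

(* For J large, the J-th partial sum of f and that of fex differ by the windows
   n <= Nmu and Nmu < n <= N of the noise and N < n <= J of fex. *)
Lemma tsvd_error_bound (fex gex g f : R -> R) (delta N : R) :
    L2norm muF fex <= E -> HT_eq a1 a2 a3 a4 fex gex ->
    0 < delta -> L2 muG g -> L2norm muG (fun x => g x - gex x) <= delta ->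
    tsvd a1 a2 a3 a4 u v s N g f -> Nmu%:R < N ->
  L2norm muF (Chi (fun x => f x - fex x)) <=
    delta * expR (al * Nmu%:R) / A
    + delta * (B / A * (expR ((al - be) * (Num.floor N)%:~R) /
             Num.sqrt (1 - expR (- 2 * (al - be)))))
    + E * (B * (expR (- (be * (Num.floor N)%:~R)) / Num.sqrt (expR (2 * be) - 1))).
Proof.
move=> fexE hgex delta0 Lg gd [Lf fcvg] NN.
have [Lfex Lgex _] := hgex.
have [Lu ou ucvg] := ss_u hsvd; have [Lv ov _] := ss_v hsvd.
have LMu c m k := L2_window_sum c m k Lu.
have NM : Nmu%:Z <= Num.floor N by rewrite floor_ge_int ltW.
have [kk Mkk] : exists kk : nat, Num.floor N = Nmu%:Z + kk%:Z.
  by exists `|(Num.floor N - Nmu%:Z)|%N; lia.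
have MkkB : Num.floor N - kk%:Z = Nmu%:Z by rewrite Mkk addrK.
pose d n := L2inner muG (fun x => g x - gex x) (v n).
pose c n := L2inner muF fex (u n).
have dle m k : \sum_(j < k) d (m - j%:Z) ^+ 2 <= delta ^+ 2.
  apply: le_trans (bessel_window _ ov _ _ (L2B Lg Lgex)) _ => //.
  by rewrite ler_sqr ?nnegrE ?L2norm_ge0// ltW.
have cle m k : \sum_(j < k) c (m - j%:Z) ^+ 2 <= E ^+ 2.
  apply: le_trans (bessel_window _ ou _ _ Lfex) _ => //.
  by rewrite ler_sqr ?nnegrE ?L2norm_ge0// ltW.
pose S (k : nat) := window_sum (fun n => d n / s n + c n) u (Num.floor N) k.
pose T (k : nat) := window_sum c u k%:Z k.*2.+1.
(* The shift aligns the lower ends: from the floor of [N], which is [Nmu + kk], a window of length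
   [k + kk + Nmu + 1] stops at index [- k], as does [T k]. *)
have Scvg : L2norm muF (fun x => S (k + (kk + Nmu.+1))%N x - f x) @[k --> \oo] --> (0 : R).
  have cE : (fun n => L2inner muG g (v n) / s n) = (fun n => d n / s n + c n).
    by apply/funext => n; exact: ss_coef.
  by move: fcvg; rewrite cE => fcvg; exact: (@cvg_comp _ _ _
    (fun k => (k + (kk + Nmu.+1))%N) (fun k => L2norm muF (fun x => S k x - f x))
    _ _ _ (cvg_addnr _) fcvg).
have Tcvg : L2norm muF (fun x => T k x - fex x) @[k --> \oo] --> (0 : R) by exact: ucvg.
set bnd := (X in _ <= X).
(* It suffices to bound the error, for all large [J], by [bnd] plus the two approximation errors,
   which vanish in the limit. *)
have := cvgD (cvgD Scvg Tcvg) (@cvg_cst R bnd nat \oo _).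
rewrite !add0r => bcvg; apply: (cvgr_to_ge (bcvg _ _ _)).
near=> J.
have JM : Num.floor N <= J%:Z.
  apply: le_trans (ler_norm _) _; rewrite -abszE lez_nat.
  by near: J; exact: nbhs_infty_ge.
have [l Jl] : exists l : nat, J%:Z = Num.floor N + l%:Z.
  by exists `|(J%:Z - Num.floor N)|%N; lia.
have SE : S (J + (kk + Nmu.+1))%N = fun x =>
    window_sum (fun n => d n / s n) u (Nmu%:Z + kk%:Z) kk x +
    window_sum (fun n => d n / s n) u Nmu%:Z (J + Nmu.+1) x +
    (window_sum c u (Num.floor N) kk x + window_sum c u Nmu%:Z (J + Nmu.+1) x).
  apply/funext => x; rewrite /S addnCA window_sum_cat MkkB !window_sumD Mkk.
  by rewrite addrACA.
have TE : T J = fun x =>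
    window_sum c u (Num.floor N + l%:Z) l x +
    (window_sum c u (Num.floor N) kk x + window_sum c u Nmu%:Z (J + Nmu.+1) x).
  apply/funext => x; rewrite /T.
  rewrite (_ : J.*2.+1 = (l + (kk + (J + Nmu.+1)))%N); last by lia.
  by rewrite !window_sum_cat Jl addrK MkkB.
pose P x := window_sum (fun n => d n / s n) u (Nmu%:Z + kk%:Z) kk x.
pose Q x := window_sum (fun n => d n / s n) u Nmu%:Z (J + Nmu.+1) x.
pose H x := window_sum c u (Num.floor N + l%:Z) l x.
have LSJ : L2 muF (S (J + (kk + Nmu.+1))%N) by exact: LMu.
have LTJ : L2 muF (T J) by exact: LMu.
(* The exact coefficients up to the floor of [N] occur in both partial sums and cancel, leaving the
   noise windows [P], [Q] and the truncated tail [H]. *)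
have dec : Chi (fun x => f x - fex x) = fun x =>
   Chi (fun x => f x - S (J + (kk + Nmu.+1))%N x) x + Chi (fun x => T J x - fex x) x
   + (Chi Q x + Chi P x + -1 * Chi H x).
  by apply/funext => x; rewrite /chi TE SE -/(P x) -/(Q x) -/(H x); ring.
have Lc h : L2 muF h -> L2 muF (Chi h) by move=> /(L2_chi a2 a3 mu)[].
have nc h : L2 muF h -> L2norm muF (Chi h) <= L2norm muF h.
  by move=> /(L2_chi a2 a3 mu)[].
have LP : L2 muF P by exact: LMu.
have LQ : L2 muF Q by exact: LMu.
have LH : L2 muF H by exact: LMu.
have LfS := L2B Lf LSJ.
have LTf := L2B LTJ Lfex.
have LQP := L2D (Lc _ LQ) (Lc _ LP).
have LZH := L2Z (-1) (Lc _ LH).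
rewrite dec.
apply: le_trans (ler_L2normD (L2D (Lc _ LfS) (Lc _ LTf)) (L2D LQP LZH)) _.
apply: lerD.
  apply: le_trans (ler_L2normD (Lc _ LfS) (Lc _ LTf)) _.
  by apply: lerD; rewrite (le_trans (nc _ _))// L2normB.
apply: le_trans (ler_L2normD LQP LZH) _.
rewrite L2normZ// ?normrN ?normr1 ?mul1r; last exact: Lc.
apply: lerD; last exact: high_window_bound.
apply: le_trans (ler_L2normD (Lc _ LQ) (Lc _ LP)) _.
rewrite /bnd Mkk; apply: lerD.
- by apply: low_window_bound => //; exact: ltW.
- by apply: mid_window_bound => //; exact: ltW.
Unshelve. all: by end_near.
Qed.
End ErrorBound.

(** * The exponents and the cut-off *)

Section Exponents.
Context {R : realType}.

(** For [al <= 0] the lower bound would stay at least [A], which contradicts the convergence of [s]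
    to 0. *)
Lemma decay_rate_gt0 (s : int -> R) (A al : R) (N0 : nat) : 0 < A ->
  (forall n : int, N0%:Z < n -> A * expR (- (al * n%:~R)) <= s n) ->
  s k%:Z @[k --> \oo] --> (0 : R) -> 0 < al.
Proof.
move=> A0 hs s0; rewrite ltNge; apply/negP => al0.
suff : A <= 0 by rewrite leNgt A0.
apply: (cvgr_to_ge s0); near=> k.
apply: (le_trans _ (hs k _)); last by rewrite ltz_nat; near: k; exact: nbhs_infty_gt.
by rewrite ler_peMr ?(ltW A0)// -expR0 ler_expR -mulNr mulr_ge0// oppr_ge0.
Unshelve. all: by end_near. Qed.

Context (a1 a2 a3 a4 mu : R).
Hypotheses (ha12 : a1 < a2) (ha23 : a2 < a3) (ha34 : a3 < a4)
  (hmu : 0 < mu < a3 - a2).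
Local Notation P := (quartic a1 a2 a3 a4).
Local Notation w := (fun x => (Num.sqrt (P x))^-1).

Lemma quartic_gt0 x : a2 < x < a3 -> 0 < P x.
Proof.
move=> /andP[x2 x3]; rewrite /quartic -mulrA mulr_gt0//.
  by rewrite mulr_gt0// subr_gt0// (lt_trans ha12).
by rewrite nmulr_rgt0 subr_lt0// (lt_trans x3).
Qed.

(** Each of the four factors of [P] is at most [L] in absolute value, so the weight is bounded below
    by the positive constant [(L ^+ 2)^-1]. *)
Lemma Rintegral_weight_gt0 b c : a2 <= b -> b < c -> c <= a3 ->
  (@lebesgue_measure R).-integrable `]b, c[ (EFin \o w) ->
  0 < \int[@lebesgue_measure R]_(x in `]b, c[) w x.
Proof.
move: (ha12) (ha23) (ha34) => a12 a23 a34.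
move=> a2b bc ca3 iw; pose L := a4 - a1.
have L0 : 0 < L by rewrite subr_gt0 (lt_trans ha12)// (lt_trans ha23).
apply: (@lt_le_trans _ _ (\int[@lebesgue_measure R]_(x in `]b, c[) (L ^+ 2)^-1)).
  rewrite Rintegral_cst//= lebesgue_measure_itv/= lte_fin bc -EFinD/=.
  by rewrite mulr_gt0 ?invr_gt0 ?exprn_gt0// subr_gt0.
apply: le_Rintegral => //.
  apply: measurable_bounded_integrable => //.
    by rewrite /= lebesgue_measure_itv/= lte_fin bc -EFinD ltry.
  exact: bounded_cst.
move=> x /=; rewrite in_itv/= => /andP[bx xc].
have P0 : 0 < P x by apply: quartic_gt0; lra.
rewrite lef_pV2 ?posrE ?sqrtr_gt0 ?exprn_gt0//.
rewrite -(ger0_norm (sqr_ge0 L)) -sqrtr_sqr ler_wsqrtr//.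
have -> : P x = ((x - a1) * (x - a2)) * ((a3 - x) * (a4 - x)).
  by rewrite /quartic; ring.
have h1 : (x - a1) * (x - a2) <= L ^+ 2.
  by rewrite expr2; apply: ler_pM; rewrite /L; lra.
have h2 : (a3 - x) * (a4 - x) <= L ^+ 2.
  by rewrite expr2; apply: ler_pM; rewrite /L; lra.
by rewrite [leRHS]expr2; apply: ler_pM; rewrite // mulr_ge0//; lra.
Qed.

Lemma measurable_weight : measurable_fun (`]a2, a3[%classic : set R) w.
Proof.
apply: open_continuous_measurable_fun => //.
move=> x /[!inE]/=; rewrite in_itv/= => xa.
have P0 := quartic_gt0 xa.
apply: (@continuousV _ _ _ x); first by rewrite gt_eqF// sqrtr_gt0.
apply: (@continuous_comp _ _ _ P Num.sqrt); last exact: sqrt_continuous.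
have cB a : {for x, continuous (fun x : R => x - a)}.
  by move=> ?; apply: cvgB; [exact: cvg_id|exact: cvg_cst].
rewrite /quartic.
by do 3 (apply: continuousM; last exact: cB); exact: cB.
Qed.

(* Rocq's real-valued integral is 0 when the extended one is infinite, so that
   [0 < alpha] gives at once the positivity of Kminus and the integrability of
   1 / sqrt P on ]a2, a3[. *)
Lemma exponents_bounds : 0 < alpha a1 a2 a3 a4 ->
  0 < beta a1 a2 a3 a4 mu < alpha a1 a2 a3 a4.
Proof.
rewrite /alpha /beta => al0; case/andP: hmu => mu0 mu1.
have K0 : 0 <= Kplus a1 a2 a3 a4.
  by apply: Rintegral_ge0 => x _; rewrite invr_ge0 sqrtr_ge0.
have K0' : 0 <= Kminus a1 a2 a3 a4.
  by apply: Rintegral_ge0 => x _; rewrite invr_ge0 sqrtr_ge0.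
have Kp : Kplus a1 a2 a3 a4 != 0.
  by apply/eqP => K; move: al0; rewrite K mulr0 mul0r ltxx.
have Km : 0 < Kminus a1 a2 a3 a4.
  rewrite lt_neqAle K0' andbT eq_sym; apply/eqP => K.
  by move: al0; rewrite K invr0 mulr0 ltxx.
have iw : (@lebesgue_measure R).-integrable `]a2, a3[ (EFin \o w).
  apply/integrableP; split; first by apply/measurable_EFinP; exact: measurable_weight.
  under eq_integral do rewrite /= ger0_norm ?invr_ge0 ?sqrtr_ge0//.
  rewrite ltey; apply/eqP => Koo; move: Kp.
  by rewrite /Kplus /Rintegral Koo eqxx.
(* The piece over []a2, a3 - mu[] is the gap between [Kplus] and the integral in [beta]; its
   positivity gives the strict upper bound. *)
have split3 : Kplus a1 a2 a3 a4 =
    \int[lebesgue_measure]_(x in `]a2, a3 - mu[) w x +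
    \int[lebesgue_measure]_(x in `]a3 - mu, a3[) w x.
  apply/eqP; rewrite addrC -subr_eq Rintegral_itv_bndo_bndc//.
    rewrite /Kplus Rintegral_itvB// bnd_simp; lra.
  by apply: integrableS iw => //; apply: subset_itvl; rewrite bnd_simp; lra.
have pi0 := pi_gt0 R.
have J1 : 0 < \int[@lebesgue_measure R]_(x in `]a2, a3 - mu[) w x.
  apply: Rintegral_weight_gt0; rewrite //; try by lra.
  by apply: integrableS iw => //; apply: subset_itvl; rewrite bnd_simp; lra.
have J2 : 0 < \int[@lebesgue_measure R]_(x in `]a3 - mu, a3[) w x.
  apply: Rintegral_weight_gt0; rewrite //; try by lra.
  by apply: integrableS iw => //; apply: subset_itvr; rewrite bnd_simp; lra.
rewrite mulr_gt0 ?divr_gt0//= mulrAC ltr_pM2r ?invr_gt0// ltr_pM2l//.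
by rewrite split3 ltrDr.
Qed.

End Exponents.

(* X stands for e^(al N), P for e^(- be N), x and y for the two rounding
   corrections; V is the value for which the variance term and the bias term
   add up to this closed form. *)
Lemma cutoff_balance (R : realType) (be al A B E V S1 S2 P x y X delta : R) :
  0 < be -> be < al -> 0 < A -> 0 < delta -> S1 != 0 -> S2 != 0 ->
  V = be / (al - be) * (S1 / S2) -> X = E * A * V / delta ->
  delta * (B / A * (X * P * x / S1)) + E * (B * (P * y / S2)) =
  E * B * P * (al / ((al - be) * S2)) * ((be * x + (al - be) * y) / al).
Proof.
move=> be0 beal A0 delta0 S10 S20 -> ->; field.
by rewrite S10 S20 !gt_eqF// ?subr_gt0// (lt_trans be0).
Qed.

(** * The error bound at the chosen cut-off, and its limit for vanishing noise *)

Theorem corollary1 (R : realType) (a1 a2 a3 a4 : R)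
  (ha12 : a1 < a2) (ha23 : a2 < a3) (ha34 : a3 < a4)
  (u v : int -> R -> R) (s : int -> R)
  (hsvd : singular_system a1 a2 a3 a4 u v s)
  (hasym : singular_values_asymptotics a1 a2 a3 a4 s)
  (mu : R) (hmu : 0 < mu < a3 - a2)
  (hP1 : forall n, 0 < s n < 1)
  (N0 : nat) (A : R) (hA : 0 < A < 2)
  (hP2 : forall n : int, N0%:Z < n ->
    A * expR (- (alpha a1 a2 a3 a4 * n%:~R)) <= s n)
  (Nmu : nat) (hN : (N0 < Nmu)%N) (B : R) (hB : 0 < B)
  (hP3 : forall n : int, Nmu%:Z < n ->
    L2norm (leb_itv a2 a4) (chi a2 a3 mu (u n))
      <= B * expR (- (beta a1 a2 a3 a4 mu * n%:~R)))
  (E : R) (hE : 0 < E)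
  (fex gex : R -> R) (hfexE : L2norm (leb_itv a2 a4) fex <= E)
  (hgex : HT_eq a1 a2 a3 a4 fex gex) :
  let al := alpha a1 a2 a3 a4 in
  let be := beta a1 a2 a3 a4 mu in
  let V := Vmu a1 a2 a3 a4 mu in
  let N := cutoff a1 a2 a3 a4 E A mu in
  let noisy (delta : R) (g : R -> R) :=
    L2 (leb_itv a1 a3) g /\
    L2norm (leb_itv a1 a3) (fun x => g x - gex x) <= delta in
  let error (f : R -> R) :=
    L2norm (leb_itv a2 a4) (chi a2 a3 mu (fun x => f x - fex x)) in
  [/\ forall g f : R -> R -> R,
        (forall delta, 0 < delta -> noisy delta (g delta)) ->
        (forall delta, 0 < delta ->
           tsvd a1 a2 a3 a4 u v s (N delta) (g delta) (f delta)) ->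
        error (f delta) @[delta --> 0^'+] --> (0 : R),
      forall (delta : R) (g f : R -> R),
        0 < delta -> noisy delta g -> tsvd a1 a2 a3 a4 u v s (N delta) g f ->
        Nmu%:R < N delta -> N delta \is a Num.int ->
        error f <= delta * expR (al * Nmu%:R) / A +
          E * B * (delta / (A * V * E)) `^ (be / al) *
          (al / ((al - be) * Num.sqrt (expR (2 * be) - 1))) &
      forall (delta : R) (g f : R -> R),
        0 < delta -> noisy delta g -> tsvd a1 a2 a3 a4 u v s (N delta) g f ->
        Nmu%:R < N delta ->
        error f <= delta * expR (al * Nmu%:R) / A +
          E * B * (delta / (A * V * E)) `^ (be / al) *
          (al / ((al - be) * Num.sqrt (expR (2 * be) - 1))) *
          rounding a1 a2 a3 a4 mu (N delta - (Num.floor (N delta))%:~R)].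
Proof.
move=> al be V N noisy error.
have [Lfex Lgex _] := hgex.
have s_gt0 n : 0 < s n by case/andP: (hP1 n).
have {hA} A0 : 0 < A by case/andP: hA.
have al0 : 0 < al by exact: decay_rate_gt0 A0 hP2 (ss_pinfty hsvd).
have /andP[be0 beal] : 0 < be < al by exact: exponents_bounds.
have NE delta : N delta = al^-1 * ln (E * A * V / delta) by [].
have roundingE theta : rounding a1 a2 a3 a4 mu theta =
  (be * expR (- ((al - be) * theta)) + (al - be) * expR (be * theta)) / al by [].
have {}hP2 n : N0%:Z < n -> A * expR (- (al * n%:~R)) <= s n by exact: hP2.
have {}hP3 n : Nmu%:Z < n ->
    L2norm (leb_itv a2 a4) (chi a2 a3 mu (u n)) <= B * expR (- (be * n%:~R)).
  exact: hP3.
have albe0 : 0 < al - be by rewrite subr_gt0.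
have q1 : expR (- 2 * (al - be)) < 1 by rewrite expR_lt1; lra.
have q2 : 1 < expR (2 * be) by rewrite expR_gt1; lra.
have S10 : 0 < Num.sqrt (1 - expR (- 2 * (al - be))).
  by rewrite sqrtr_gt0 subr_gt0.
have S20 : 0 < Num.sqrt (expR (2 * be) - 1) by rewrite sqrtr_gt0 subr_gt0.
have VE : V = be / (al - be) * (Num.sqrt (1 - expR (- 2 * (al - be))) /
    Num.sqrt (expR (2 * be) - 1)).
  by rewrite /V /Vmu -/al -/be sqrtrM ?sqrtrV// subr_ge0 ltW.
clearbody al be V N.
have V0 : 0 < V by rewrite VE mulr_gt0 ?divr_gt0.
have EAV : 0 < E * A * V by rewrite !mulr_gt0.
(* The bound for a real cut-off rounded down is the third claim, and the other two are derived from
   it. *)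
have bound (delta : R) (g f : R -> R) :
    0 < delta -> noisy delta g -> tsvd a1 a2 a3 a4 u v s (N delta) g f ->
    Nmu%:R < N delta ->
    error f <= delta * expR (al * Nmu%:R) / A +
      E * B * (delta / (A * V * E)) `^ (be / al) *
      (al / ((al - be) * Num.sqrt (expR (2 * be) - 1))) *
      rounding a1 a2 a3 a4 mu (N delta - (Num.floor (N delta))%:~R).
  move=> delta0 [Lg gd] hf NN.
  apply: le_trans (tsvd_error_bound hsvd s_gt0 be0 beal A0 hB hE hN hP2 hP3
    hfexE hgex delta0 Lg gd hf NN) _.
  rewrite -addrA lerD2l.
  set M : R := (Num.floor _)%:~R; set theta := N delta - M.
  have alN : al * N delta = ln (E * A * V / delta).
    by rewrite NE mulrA mulfV ?mul1r// gt_eqF.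
  have X0 : 0 < E * A * V / delta by rewrite divr_gt0.
  have XE : expR (al * N delta) = E * A * V / delta by rewrite alN lnK.
  (* The base is the inverse of [expR (al * N delta)], by the choice of the cut-off. *)
  have -> : (delta / (A * V * E)) `^ (be / al) = expR (- (be * N delta)).
    have -> : delta / (A * V * E) = (E * A * V / delta)^-1.
      by rewrite invf_div; congr (_ / _); ring.
    rewrite /powR gt_eqF ?invr_gt0// lnV ?posrE// -alN; congr expR.
    by field; rewrite gt_eqF.
  have -> : expR ((al - be) * M) =
      expR (al * N delta) * expR (- (be * N delta)) * expR (- ((al - be) * theta)).
    by rewrite -!expRD; congr expR; rewrite /theta; ring.
  have -> : expR (- (be * M)) = expR (- (be * N delta)) * expR (be * theta).
    by rewrite -expRD; congr expR; rewrite /theta; ring.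
  by rewrite roundingE (cutoff_balance B _ _ _ be0 beal A0 delta0
    (lt0r_neq0 S10) (lt0r_neq0 S20) VE XE).
split=> //; last first.
  move=> delta g f delta0 hg hf NN; rewrite intrEfloor => /eqP Nint.
  apply: le_trans (bound _ _ _ delta0 hg hf NN) _.
  (* At an integer cut-off the fractional part is 0 and the correction is [(be + (al - be)) / al],
     that is 1. *)
  rewrite Nint subrr roundingE !mulr0 oppr0 expR0 !mulr1.
  by rewrite (addrC be) subrK divff ?mulr1// gt_eqF.
move=> g f hg hf.
(* [C] bounds the rounding correction for every fractional part: on the unit interval its decreasing
   exponential is at most 1, its increasing one at most [expR be]. *)
pose C := (be + (al - be) * expR be) / al.
pose K := al / ((al - be) * Num.sqrt (expR (2 * be) - 1)).
have K0 : 0 <= K by rewrite ltW// divr_gt0// mulr_gt0// subr_gt0.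
have hC theta : 0 <= theta <= 1 -> rounding a1 a2 a3 a4 mu theta <= C.
  move=> /andP[t0 t1]; rewrite roundingE ler_pM2r ?invr_gt0//.
  apply: lerD; rewrite ?ger_pMr ?ler_pM2l ?subr_gt0//.
    by rewrite -expR0 ler_expR oppr_le0 mulr_ge0// subr_ge0 ltW.
  by rewrite ler_expR ger_pMr.
pose c1 := expR (al * Nmu%:R) / A.
pose c2 := E * B * (A * V * E)^-1 `^ (be / al) * K * C.
apply: (@squeeze_cvgr _ _ _ _ (fun=> 0)
  (fun delta => delta * c1 + delta `^ (be / al) * c2)).
- near=> delta.
  have delta0 : 0 < delta by near: delta; exact: nbhs_right_gt.
  rewrite L2norm_ge0/=.
  (* Solved for [delta], this reads [delta < E * A * V / expR (Nmu%:R * al)], which holds near 0. *)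
  have NN : Nmu%:R < N delta.
    rewrite NE mulrC ltr_pdivlMr//.
    rewrite -[X in X < _]expRK ltr_ln ?posrE ?expR_gt0 ?divr_gt0//.
    rewrite ltr_pdivlMr// mulrC -ltr_pdivlMr ?expR_gt0//.
    by near: delta; apply: nbhs_right_lt; rewrite divr_gt0 ?expR_gt0.
  apply: le_trans (bound _ _ _ delta0 (hg _ delta0) (hf _ delta0) NN) _.
  rewrite -[delta * expR _ / A]mulrA -/c1 lerD2l.
  have -> : delta `^ (be / al) * c2 = E * B * (delta / (A * V * E)) `^ (be / al) * K * C.
    rewrite powRM ?(ltW delta0)//; first by rewrite /c2; ring.
    by rewrite invr_ge0 !mulr_ge0// ltW.
  rewrite ler_wpM2l//; first by rewrite mulr_ge0// mulr_ge0 ?powR_ge0// ltW ?mulr_gt0.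
  apply: hC; rewrite subr_ge0 floor_le/= lerBlDr addrC.
  by rewrite ltW// -intrD1 floorD1_gt.
- exact: cvg_cst.
- have d0 : delta @[delta --> (0 : R)^'+] --> (0 : R).
    by exact: cvg_at_right_filter cvg_id.
  have p0 : delta `^ (be / al) @[delta --> (0 : R)^'+] --> (0 : R).
    by apply: powR_cvg0; rewrite divr_gt0.
  have := cvgD (cvgM d0 (cvg_cst c1)) (cvgM p0 (cvg_cst c2)).
  by rewrite !mul0r addr0; apply.
Unshelve. all: by end_near.
Qed.
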